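(* Let $b$ be a real-valued measurable function on $\mathbb R^n$. Let $\Omega$ be a real-valued measurable function on $\mathbb S^{n-1}$, extended to $\mathbb R^n\setminus\{0\}$ as a homogeneous function of degree zero, for which there is an open subset of $\mathbb S^{n-1}$ on which $\Omega$ does not change sign and is not equivalent to zero. Then for every $\gamma\in(0,1)$ there exist $\epsilon_0>0$ and $k_0>10\sqrt n$, depending only on $\Omega$, $\gamma$ and $n$, such that the following holds. For every cube $Q$ there exist another cube $P$ with the same side length as $Q$ satisfying $|c_Q-c_P|=k_0l_Q$, measurable sets $E_1,E_2\subset Q$ with $Q=E_1\cup E_2$, and measurable sets $F_1,F_2\subset P$ with $|F_1|=|F_2|=\frac12|Q|$, such that (1) $b(x)-b(y)$ does not change sign for $(x,y)\in E_i\times F_i$, $i=1,2$; (2) $|b(x)-m_b(P)|\le|b(x)-b(y)|$ for all $(x,y)\in E_i\times F_i$, $i=1,2$; (3) $\Omega(x-y)$ does not change sign for $(x,y)\in Q\times P$; (4) $|N_x\cap P|\le\gamma|Q|$ for all $x\in Q$, where $N_x:=\{y\in\mathbb R^n:\ |\Omega(x-y)|<\epsilon_0\}$.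
   Context: Cubes in $\mathbb R^n$ are closed with sides parallel to the coordinate axes; $c_Q$ and $l_Q$ denote the center and side length of $Q$. A median value $m_b(P)$ of a real-valued measurable function $b$ over a cube $P$ is a (possibly nonunique) real number such that $|\{x\in P:b(x)>m_b(P)\}|\le|P|/2$ and $|\{x\in P:b(x)<m_b(P)\}|\le|P|/2$; in the statement $m_b(P)$ is a fixed median value of $b$ over $P$. ''Does not change sign'' on a set means being everywhere $\ge0$ or everywhere $\le0$ on that set. *)

(* Defs.v *)
From HB Require Import structures.
From mathcomp Require Import all_boot all_order all_algebra.
From mathcomp Require Import all_classical all_reals all_analysis.
Import Order.TTheory GRing.Theory Num.Theory.
Import numFieldNormedType.Exports.

Set Implicit Arguments.
Unset Strict Implicit.
Unset Printing Implicit Defensive.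

Local Open Scope classical_set_scope.
Local Open Scope ring_scope.

(* R^n, n >= 1, is 'rV[R]_n.+1 with the index shifted by one. The library norm
   on row vectors is the sup norm, hence the explicit Euclidean norm. *)
Section lebesgue.
Context {R : realType} {n : nat}.
Local Notation Rn := 'rV[R]_n.+1.

Definition enorm (x : Rn) : R := Num.sqrt (\sum_i x 0 i ^+ 2).

(* The box [I.1, I.2]; it is empty, and has volume 0, when I.2 0 i < I.1 0 i
   for some i. *)
Definition box (I : Rn * Rn) : set Rn :=
  [set x | forall i, I.1 0 i <= x 0 i <= I.2 0 i].

Definition box_vol (I : Rn * Rn) : R := \prod_i Num.max 0 (I.2 0 i - I.1 0 i).

Definition box_cover (A : set Rn) : set (nat -> Rn * Rn) :=
  [set I | A `<=` \bigcup_k box (I k)].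

(* Lebesgue outer measure. On the Lebesgue measurable sets, which are its
   Caratheodory measurable sets, it is Lebesgue measure. *)
Definition leb (A : set Rn) : \bar R :=
  ereal_inf [set (\sum_(k <oo) (box_vol (I k))%:E)%E | I in box_cover A].

Let vol (I : Rn * Rn) : \bar R := (box_vol I)%:E.

Let vol_ge0 I : (0 <= vol I)%E.
Proof. by rewrite lee_fin prodr_ge0// => i _; rewrite le_max lexx. Qed.

Let leb_ge0 A : (0 <= leb A)%E.
Proof.
apply: le_ereal_inf_tmp => _ [I _ <-].
by apply: nneseries_ge0 => k _ _; exact: vol_ge0.
Qed.

Let leb0 : leb set0 = 0%E.
Proof.
apply/eqP; rewrite eq_le leb_ge0 andbT.
apply: ereal_inf_lbound; exists (fun=> (0, 0)); first by [].
apply: eseries0 => k _ _; congr EFin.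
by rewrite /box_vol big_ord_recl !mxE subrr maxxx mul0r.
Qed.

Let le_leb : {homo leb : A B / A `<=` B >-> (A <= B)%E}.
Proof.
move=> A B AB; apply: ereal_inf_le_tmp => _ [I BI <-].
by exists I => //; exact: subset_trans BI.
Qed.

Let leb_sigma_subadditive : sigma_subadditive leb.
Proof.
move=> A; have [[i ioo]|] := pselect (exists i, leb (A i) = +oo%E).
  rewrite (eseries_pinfty _ _ ioo) ?leey// => k _.
  by rewrite -ltNye (lt_le_trans _ (leb_ge0 _)).
rewrite -forallNE => Aoo.
suff add2e (e : {posnum R}) :
    (leb (\bigcup_k A k) <= \sum_(i <oo) leb (A i) + e%:num%:E)%E.
  by apply/lee_addgt0Pr => _/posnumP[].
apply: le_trans (epsilon_trick _ _ _) => //.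
pose P k (I : nat -> Rn * Rn) := box_cover (A k) I /\
  (\sum_(j <oo) vol (I j) <= leb (A k) + (e%:num / (2 ^ k.+1)%:R)%:E)%E.
have [G PG] : {G : nat -> nat -> Rn * Rn & forall k, P k (G k)}.
  apply: (@choice _ _ P) => k.
  have en1 : 0 < e%:num / (2 ^ k.+1)%:R :> R by [].
  have fk : leb (A k) \is a fin_num.
    by rewrite ge0_fin_numE// ltey; apply/eqP; exact: Aoo.
  have [_ [I AI <-] /ltW le_I] := lb_ereal_inf_adherent en1 fk.
  by exists I; split.
have /card_esym/ppcard_eqP[f] := card_nat2.
apply: (@le_trans _ _ (\esum_(i in setT) (vol \o uncurry G) i)%E).
  apply: ereal_inf_lbound; exists (uncurry G \o f).
    move=> t [i _ /(PG i).1 [j _ Gij]]; exists (f^-1%FUN (i, j)) => //=.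
    by rewrite invK ?inE.
  rewrite -(esum_pred_image (vol \o uncurry G) _ xpredT) ?[fun=> _]set_true//.
    by rewrite image_eq.
  by move=> ? _; exact: vol_ge0.
rewrite (_ : esum _ _ = \sum_(i <oo) \sum_(j <oo) vol (G i j))%E; last first.
  pose J : nat -> set (nat * nat) := fun i => [set (i, j) | j in setT].
  rewrite (_ : setT = \bigcup_k J k); last first.
    by rewrite predeqE => -[a b]; split => // _; exists a => //; exists b.
  rewrite esum_bigcupT /=; last 2 first.
  - apply/trivIsetP => i j _ _ ij.
    rewrite predeqE => -[k m] /=; split => //= -[] [_] _ [<-{k} _].
    by move=> [m' _] [] /esym/eqP; rewrite (negbTE ij).
  - by move=> *; exact: vol_ge0.
  rewrite -(image_id [set: nat]) -fun_true esum_pred_image//; last first.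
    by move=> k _; apply: esum_ge0 => *; exact: vol_ge0.
  apply: eq_eseriesr => /= j _.
  rewrite -(esum_pred_image (vol \o uncurry G) (pair j) predT)//=.
  - by congr esum; rewrite predeqE => -[a b]; split; move=> [i _ <-]; exists i.
  - by move=> ? ? _ _; exact: (@can_inj _ _ _ snd).
by apply: lee_nneseries => [i _ _|i _];
  [apply: nneseries_ge0 => *; exact: vol_ge0|exact: (PG i).2].
Qed.

HB.instance Definition _ := isOuterMeasure.Build R Rn leb
  leb0 leb_ge0 le_leb leb_sigma_subadditive.

End lebesgue.

Section sphere.
Context {R : realType} {n : nat}.
Local Notation Rn := 'rV[R]_n.+1.

Definition lebesgue_measurable (A : set Rn) := leb.-cara.-measurable A.

Definition lebesgue_measurable_fun (f : Rn -> R) :=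
  measurable_fun [set: caratheodory_type leb] f.

Definition sphere : set Rn := [set x | enorm x = 1].

Definition cone (A : set Rn) : set Rn :=
  [set x | exists r t, [/\ 0 < r <= 1, A t & x = r *: t]].

(* Surface measure on the unit sphere, through polar coordinates: a subset of
   the sphere is measurable iff its cone is Lebesgue measurable, and its
   measure is then the dimension times the volume of the cone (for S^0 this is
   the counting measure). *)
Definition sphere_measure (A : set Rn) : \bar R := (n.+1%:R%:E * leb (cone A))%E.

Definition sphere_measurable_fun (f : Rn -> R) :=
  forall B : set R, measurable B ->
    lebesgue_measurable (cone (sphere `&` f @^-1` B)).

Definition sphere_open (U : set Rn) :=
  exists2 V : set Rn, open V & U = sphere `&` V.

(* Extension, homogeneous of degree 0, of the restriction of f to the sphere.
   The value at the origin carries no meaning. *)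
Definition hext (f : Rn -> R) (x : Rn) : R := f ((enorm x)^-1 *: x).

End sphere.

Definition constant_sign {R : realType} {T : Type} (A : set T) (f : T -> R) :=
  (forall x, A x -> 0 <= f x) \/ (forall x, A x -> f x <= 0).

Record cube (R : realType) (n : nat) := Cube {
  cube_center : 'rV[R]_n.+1;
  cube_side : R;
  cube_side_gt0 : 0 < cube_side }.

Definition cube_set {R : realType} {n : nat} (Q : cube R n) : set 'rV[R]_n.+1 :=
  [set x | forall i, `|x 0 i - cube_center Q 0 i| <= cube_side Q / 2].

Definition is_median {R : realType} {n : nat} (b : 'rV[R]_n.+1 -> R)
    (P : cube R n) (m : R) :=
  (leb (cube_set P `&` [set x | (m < b x)%R]) <= 2^-1%:E * leb (cube_set P))%E /\
  (leb (cube_set P `&` [set x | (b x < m)%R]) <= 2^-1%:E * leb (cube_set P))%E.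

(* Main.v *)
Require Import Defs.
From HB Require Import structures.
From mathcomp Require Import all_boot all_order all_algebra.
From mathcomp Require Import all_classical all_reals all_analysis.
From mathcomp Require Import measurable_realfun ring lra.
Import Order.TTheory GRing.Theory Num.Theory.
Import numFieldNormedType.Exports.

Set Implicit Arguments.
Unset Strict Implicit.
Unset Printing Implicit Defensive.

Local Open Scope classical_set_scope.
Local Open Scope ring_scope.

(** The set of [z] whose direction lies in the given open set and satisfies
    [|Omega| >= eps] has positive measure for some [eps]. A set [A] of positive
    finite measure has density above any [r < 1] in some arbitrarily small
    cube: otherwise, tiling by ever smaller cubes would give
    [leb (A ∩ I) <= r vol I] for every box [I], and summing over the boxes of a
    cover [leb A <= r leb A]. This yields a small cube [K], away from the
    origin and with all its directions in the open set, where [|Omega| < eps]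
    only on a proportion [gamma / 2 ^ d] of [K].

    Given [Q] with side [l], the cube [P] is the translate of [Q] for which
    every [x - y], with [x] in [Q] and [y] in [P], lies in the dilate of [K] of
    side [2 l]. Since the extension of [Omega] is constant on rays, (3) and (4)
    follow by scaling from the properties of [K]. For (1) and (2), split [Q]
    and [P] at the level [m P] of [b]; each of the two halves of [P] has measure
    at least [|P| / 2] and contains a subset of measure exactly [|P| / 2], by
    the intermediate value theorem applied to a sweeping half-space. *)

(** * Volume of a box against countable covers by boxes *)

Lemma lebesgue_measure_segment (R : realType) (a b : R) :
  lebesgue_measure `[a, b]%classic = (Num.max 0 (b - a))%:E.
Proof.
rewrite lebesgue_measure_itv/= lte_fin; case: ltP => ab.
  by rewrite -EFinB max_r// subr_ge0 ltW.
by rewrite max_l// subr_le0.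
Qed.

(* The weights [w] make the statement inductive: fixing the first coordinate
   [t] multiplies [w k] by the indicator of the first edge of the k-th box, and
   integrating over [t] gives back the length of that edge. *)
Lemma box_cover_vol (R : realType) d (a b : 'I_d -> R) (w : nat -> R)
    (lo hi : nat -> 'I_d -> R) :
  (forall k, 0 <= w k) ->
  (forall x : 'I_d -> R, (forall i, a i <= x i <= b i) ->
     exists2 k, w k = 1 & forall i, lo k i <= x i <= hi k i) ->
  ((\prod_i Num.max 0 (b i - a i))%:E <=
   \sum_(k <oo) (w k * \prod_i Num.max 0 (hi k i - lo k i))%:E)%E.
Proof.
have max_prod_ge0 e (u v : 'I_e -> R) : 0 <= \prod_i Num.max 0 (u i - v i).
  by apply: prodr_ge0 => i _; rewrite le_max lexx.
elim: d a b w lo hi => [|d IH] a b w lo hi w0 cov.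
  (* In dimension zero the covering hypothesis only says that some weight is 1, and that single term
     of the series already reaches the empty product. *)
  have [[]//|k wk1 _] := cov a.
  rewrite big_ord0.
  apply: le_trans (nneseries_lim_ge k.+1 _) => [|j _ _]; last first.
    by rewrite lee_fin big_ord0 mulr1.
  rewrite big_mkord (bigD1 ord_max)//= big_ord0 wk1 mulr1 leeDl// sume_ge0// => j _.
  by rewrite lee_fin big_ord0 mulr1.
pose D : set R := `[a ord0, b ord0]%classic.
pose J k : set R := `[lo k ord0, hi k ord0]%classic.
pose v k := \prod_i Num.max 0 (hi k (lift ord0 i) - lo k (lift ord0 i)).
pose B := \prod_i Num.max 0 (b (lift ord0 i) - a (lift ord0 i)).
have v0 k : 0 <= v k by exact: max_prod_ge0.
have B0 : 0 <= B by exact: max_prod_ge0.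
have mD : measurable D by exact: measurable_itv.
have mJ k : measurable (J k) by exact: measurable_itv.
pose g k (t : R) : \bar R := (w k * v k * \1_(J k) t)%:E.
have m1 k : measurable_fun D (\1_(J k) : R -> R).
  exact: measurable_indic (mJ k).
have mf k : measurable_fun D (g k).
  apply/measurable_EFinP; apply: measurable_funM; first exact: measurable_cst.
  exact: m1.
have slice t : D t -> (B%:E <= \sum_(k <oo) (w k * v k * \1_(J k) t)%:E)%E.
  rewrite /D/= in_itv/= => tD.
  have -> : (\sum_(k <oo) (w k * v k * \1_(J k) t)%:E =
      \sum_(k <oo) ((w k * \1_(J k) t) * v k)%:E)%E.
    by apply: eq_eseriesr => k _; rewrite mulrAC.
  apply: IH => [k|x xab]; first by rewrite mulr_ge0.
  (* The covering hypothesis is applied to the point with first coordinate [t] and remaining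
     coordinates [x]. *)
  have [|k wk1 xk] := cov (fun i => oapp x t (unlift ord0 i)).
    by move=> i; case: unliftP => [j|] ->.
  exists k => [|i]; last by have := xk (lift ord0 i); rewrite liftK.
  by rewrite wk1 mul1r indicE mem_set// /J/= in_itv/=; have := xk ord0; rewrite unlift_none.
rewrite big_ord_recl mulrC EFinM -lebesgue_measure_segment -/D.
rewrite -integral_cst//.
apply: (@le_trans _ _ (\int[lebesgue_measure]_(t in D)
   \sum_(k <oo) (w k * v k * \1_(J k) t)%:E)%E).
  apply: ge0_le_integral => //.
  apply: (@ge0_emeasurable_sum _ _ _ D g xpredT) => // k x _ _.
  by rewrite lee_fin !mulr_ge0.
rewrite integral_nneseries//; last by move=> k t _; rewrite lee_fin !mulr_ge0.
apply: lee_nneseries => [k _ _|k _].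
  by apply: integral_ge0 => t _; rewrite lee_fin !mulr_ge0.
under eq_integral do rewrite EFinM.
rewrite ge0_integralZl//; last 2 first.
  by apply/measurable_EFinP; exact: m1.
  by rewrite lee_fin mulr_ge0.
rewrite integral_indic//; last exact: mJ.
rewrite big_ord_recl mulrCA [X in (_ <= X%:E)%E]mulrC [leRHS]EFinM.
rewrite lee_wpmul2l ?lee_fin ?mulr_ge0//.
rewrite -lebesgue_measure_segment; apply: le_measure; rewrite ?inE//.
by apply: measurableI => //; exact: mJ.
Qed.

(** * Lebesgue outer measure: boxes, half-spaces and affine maps *)

Section leb_theory.
Context {R : realType} {n : nat}.
Local Notation Rn := 'rV[R]_n.+1.
Implicit Types (A X : set Rn) (I : Rn * Rn).

Lemma box_vol_ge0 I : 0 <= box_vol I.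
Proof. by apply: prodr_ge0 => i _; rewrite le_max lexx. Qed.

Lemma leb_le_cover A (I : nat -> Rn * Rn) : A `<=` \bigcup_k box (I k) ->
  (leb A <= \sum_(k <oo) (box_vol (I k))%:E)%E.
Proof. by move=> AI; apply: ereal_inf_lbound; exists I. Qed.

Lemma leb_box_le I : (leb (box I) <= (box_vol I)%:E)%E.
Proof.
(* The cover consists of [I] followed by copies of the one-point box at the origin, whose volume is
   0 because the dimension is positive. *)
apply: (@le_trans _ _ (\sum_(k <oo) (box_vol (if k is 0 then I else (0, 0)))%:E)%E).
  by apply: leb_le_cover => x xI; exists 0%N.
rewrite (nneseries_split 0 1)//; last first.
  by move=> k _; rewrite lee_fin box_vol_ge0.
rewrite big_mkord big_ord1 eseries0 ?adde0// => -[//|k] _ _; congr EFin.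
by rewrite /box_vol big_ord_recl !mxE subrr maxxx mul0r.
Qed.

(** The lower bound is [box_cover_vol] with all weights equal to 1. *)
Lemma leb_box I : leb (box I) = (box_vol I)%:E.
Proof.
apply/eqP; rewrite eq_le leb_box_le; apply: le_ereal_inf_tmp => _ [J IJ <-].
have := @box_cover_vol R n.+1 (I.1 0) (I.2 0) (fun=> 1) (fun k => (J k).1 0) (fun k => (J k).2 0).
rewrite (eq_eseriesr (g := fun k => (box_vol (J k))%:E)); last first.
  by move=> k _; rewrite mul1r.
apply => // x xI.
have [|k _ Jk] := IJ (\row_i x i); first by move=> i; rewrite mxE.
by exists k => // i; have := Jk i; rewrite mxE.
Qed.

Definition set_coord (v : Rn) i t : Rn := \row_j if j == i then t else v 0 j.

Lemma leb_bounded A I : A `<=` box I -> (leb A <= (box_vol I)%:E)%E.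
Proof. by move=> AI; rewrite -leb_box; exact: le_outer_measure. Qed.

(** Additivity of volume under a cut by a hyperplane. When the hyperplane misses the box, the
    truncation by [Num.min] or [Num.max] leaves one piece with a nonpositive edge, hence volume
    0. *)
Lemma box_vol_split I i a :
  box_vol I = box_vol (I.1, set_coord I.2 i (Num.min (I.2 0 i) a)) +
              box_vol (set_coord I.1 i (Num.max (I.1 0 i) a), I.2).
Proof.
rewrite /box_vol (bigD1 i)//= [in RHS](bigD1 i)//= [X in _ = _ + X](bigD1 i)//=.
rewrite !mxE eqxx.
under [X in _ = _ * X + _]eq_bigr => j ji do rewrite mxE (negbTE ji).
under [X in _ = _ + _ * X]eq_bigr => j ji do rewrite mxE (negbTE ji).
rewrite -mulrDl; congr (_ * _).
move: (I.1 0 i) (I.2 0 i) => l h.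
case: (leP h a) => ha; case: (leP l a) => la.
- by rewrite [X in _ = _ + X]max_l ?addr0// subr_le0.
- by rewrite [X in _ = _ + X]max_l ?addr0// subr_le0; lra.
- by rewrite !max_r ?subr_ge0//; lra.
- by rewrite [X in _ = X + _]max_l ?add0r//; lra.
Qed.

(** The hypotheses place [A] between an open half-space and its closure, so both kinds are treated
    at once. Cutting every box of a cover of [X] at the hyperplane yields covers of the two parts of
    [X] with the same total volume, which is Caratheodory's criterion. *)
Lemma half_space_measurable i a A :
  A `<=` [set x | x 0 i <= a] -> ~` A `<=` [set x | a <= x 0 i] ->
  lebesgue_measurable A.
Proof.
move=> Ale Age; apply: le_caratheodory_measurable => X.
apply: le_ereal_inf_tmp => _ [J XJ <-].
rewrite (eq_eseriesr (g := fun k =>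
  (box_vol ((J k).1, set_coord (J k).2 i (Num.min ((J k).2 0 i) a)))%:E +
  (box_vol (set_coord (J k).1 i (Num.max ((J k).1 0 i) a), (J k).2))%:E)%E);
  last by move=> k _; rewrite -EFinD -box_vol_split.
rewrite nneseriesD; try by move=> k _ _; rewrite lee_fin box_vol_ge0.
apply: leeD; apply: leb_le_cover => x [xX xA]; have [k _ Jk] := XJ _ xX;
  exists k => // j; rewrite !mxE; have := Jk j; case: eqP => // -> /andP[lo hi].
  by rewrite lo le_min hi; exact: Ale.
by rewrite hi ge_max lo andbT; exact: Age.
Qed.

Lemma measurable_coord_le i a : lebesgue_measurable [set x : Rn | x 0 i <= a].
Proof.
by apply: (@half_space_measurable i a) => // x /= /negP; rewrite -ltNge; exact: ltW.
Qed.

Lemma measurable_coord_ge i a : lebesgue_measurable [set x : Rn | a <= x 0 i].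
Proof.
have -> : [set x : Rn | a <= x 0 i] = ~` [set x | x 0 i < a].
  by apply/seteqP; split => x /=; rewrite leNgt => /negP.
apply: caratheodory_measurable_setC.
apply: (@half_space_measurable i a) => x /=; first exact: ltW.
by move/negP; rewrite -leNgt.
Qed.

Lemma measurable_box I : lebesgue_measurable (box I).
Proof.
have -> : box I = \bigcap_(i in [set: 'I_n.+1])
    ([set x : Rn | I.1 0 i <= x 0 i] `&` [set x | x 0 i <= I.2 0 i]).
  apply/seteqP; split => x xI i; first by move=> _; apply/andP; exact: xI.
  by apply/andP; exact: xI.
apply: fin_bigcap_measurable => // i _; apply: measurableI.
  exact: measurable_coord_ge.
exact: measurable_coord_le.
Qed.

(** The image of a cover by boxes is again a cover by boxes; a negative [c] exchanges the two
    corners of each box. *)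
Lemma leb_affine (v : Rn) (c : R) A : c != 0 ->
  (leb [set (v + c *: z)%R | z in A] <= (`|c| ^+ n.+1)%:E * leb A)%E.
Proof.
move=> c0; have cn0 : 0 < `|c| ^+ n.+1 by rewrite exprn_gt0// normr_gt0.
rewrite -lee_pdivrMl//; apply: le_ereal_inf_tmp => _ [J AJ <-].
rewrite lee_pdivrMl// -nneseriesZl; last first.
  by move=> k _; rewrite lee_fin box_vol_ge0.
pose J' k := if 0 < c then (v + c *: (J k).1, v + c *: (J k).2)
             else (v + c *: (J k).2, v + c *: (J k).1).
rewrite [leRHS](eq_eseriesr (g := fun k => (box_vol (J' k))%:E)); last first.
  move=> k _; rewrite -EFinM; congr EFin; rewrite /box_vol.
  rewrite -[in _ ^+ _](card_ord n.+1) -prodr_const -big_split/=.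
  apply: eq_bigr => i _; rewrite /J' maxr_pMr// mulr0.
  by case: (ltrgt0P c) c0 => [cp|cn|->]; rewrite ?eqxx//= !mxE => _; congr (Num.max _ _); ring.
apply: leb_le_cover => _ [z zA <-]; have [k _ Jk] := AJ _ zA.
exists k => // i; have /andP[lo hi] := Jk i; rewrite /J'.
case: (ltrgt0P c) c0 => [cp|cn|->]; rewrite ?eqxx//= !mxE !lerD2l => _.
  by rewrite !ler_pM2l// lo.
by rewrite !ler_nM2l// hi.
Qed.

End leb_theory.

(** * Tilings by cubes and density in small cubes *)

Section cubes.
Context {R : realType} {n : nat}.
Local Notation Rn := 'rV[R]_n.+1.
Implicit Types (A X : set Rn) (I : Rn * Rn) (Q : cube R n).

Lemma cube_setE Q : cube_set Q = box (cube_center Q - const_mx (cube_side Q / 2),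
  cube_center Q + const_mx (cube_side Q / 2)).
Proof.
by apply/seteqP; split => x xQ i; have := xQ i; rewrite !mxE ler_distl.
Qed.

Lemma measurable_cube Q : lebesgue_measurable (cube_set Q).
Proof. by rewrite cube_setE; exact: measurable_box. Qed.

Lemma leb_cube Q : leb (cube_set Q) = (cube_side Q ^+ n.+1)%:E.
Proof.
rewrite cube_setE leb_box; congr EFin.
rewrite /box_vol -[in RHS](card_ord n.+1) -prodr_const; apply: eq_bigr => i _.
rewrite !mxE (_ : _ - _ = cube_side Q); last by lra.
by rewrite max_r// ltW// cube_side_gt0.
Qed.

Lemma leb_big_setU (T : finType) (F : T -> set Rn) :
  (leb (\big[setU/set0]_f F f) <= \sum_f leb (F f))%E.
Proof.
elim/big_ind2 : _ => [|x X y Y Xx Yy|//]; first by rewrite outer_measure0.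
exact: le_trans (outer_measureU2 leb X Y) (leeD Xx Yy).
Qed.

(** A grid of cubes of side [s] starting at the lower corner covers the box and overshoots each edge
    by at most [s], whence the term [+ s]. *)
Lemma leb_tiling A I (s r : R) : 0 < s -> 0 <= r ->
  (forall Q, cube_side Q = s ->
     (leb (A `&` cube_set Q) <= (r * s ^+ n.+1)%:E)%E) ->
  (leb (A `&` box I) <=
   (r * \prod_i (Num.max 0 (I.2 0 i - I.1 0 i) + s))%:E)%E.
Proof.
move=> s0 r0 As; pose L i := Num.max 0 (I.2 0 i - I.1 0 i) / s.
have L0 i : 0 <= L i by rewrite divr_ge0 ?le_max ?lexx// ltW.
pose N i := (Num.trunc (L i)).+1.
pose T := {dffun forall i : 'I_n.+1, 'I_(N i)}.
pose K (f : T) := @Cube R n (\row_i (I.1 0 i + (f i)%:R * s + s / 2)) s s0.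
have AK : A `&` box I `<=` \big[setU/set0]_(f : T) (A `&` cube_set (K f)).
  move=> x [Ax Ix]; pose y i := (x 0 i - I.1 0 i) / s.
  have y0 i : 0 <= y i.
    by have /andP[lo _] := Ix i; rewrite divr_ge0 ?subr_ge0// ltW.
  have yN i : (Num.trunc (y i) < N i)%N.
    rewrite ltnS; apply: le_truncn; rewrite ler_pM2r ?invr_gt0// le_max.
    by have /andP[_ hi] := Ix i; rewrite lerD2r hi orbT.
  rewrite -bigcup_seq; exists [ffun i => Ordinal (yN i)] => /=.
    by rewrite mem_index_enum.
  split => // i; rewrite /= mxE ffunE/=.
  have := truncn_itv (y0 i); move: (Num.trunc (y i)) => q /andP[].
  rewrite /y ler_pdivlMr// ltr_pdivrMr// -natr1 mulrDl mul1r.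
  by move: (q%:R * s) => t tlo thi; rewrite ler_distl; apply/andP; split; lra.
apply: le_trans (le_outer_measure _ _ _ AK) _; apply: le_trans (leb_big_setU _) _.
apply: (@le_trans _ _ (\sum_(f : T) (r * s ^+ n.+1)%:E)%E).
  by apply: lee_sum => f _; exact: As.
rewrite sumEFin lee_fin sumr_const card_dep_ffun -mulr_natr -mulrA.
apply: ler_wpM2l => //.
have -> : foldr muln 1%N [seq #|{: 'I_(N x)}| | x : 'I_n.+1] = (\prod_i N i)%N.
  rewrite foldrE big_map big_enum/=; apply: eq_bigr => i _; exact: card_ord.
rewrite natr_prod mulrC -[in _ ^+ _](card_ord n.+1) -prodr_const -big_split/=.
apply: ler_prod => i _; apply/andP; split; first by rewrite mulr_ge0// ltW.
have /andP[tL _] := truncn_itv (L0 i).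
rewrite -[(N i)%:R]natr1 mulrDl mul1r lerD2r -ler_pdivlMr//.
Qed.

Lemma cube_density A (r e : R) : 0 < r < 1 -> 0 < e ->
  (0 < leb A)%E -> (leb A < +oo)%E ->
  exists2 Q, cube_side Q < e &
    ((r * cube_side Q ^+ n.+1)%:E < leb (A `&` cube_set Q))%E.
Proof.
move=> /andP[r0 r1] e0 A0 Aoo; apply: contrapT => noQ.
have small Q : cube_side Q < e ->
    (leb (A `&` cube_set Q) <= (r * cube_side Q ^+ n.+1)%:E)%E.
  by move=> Qe; rewrite leNgt; apply/negP => AQ; apply: noQ; exists Q.
have Abox I : (leb (A `&` box I) <= (r * box_vol I)%:E)%E.
  have fA : leb (A `&` box I) \is a fin_num.
    rewrite ge0_fin_numE ?outer_measure_ge0//.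
    apply: le_lt_trans (ltry (box_vol I)); apply: leb_bounded.
    exact: subIsetr.
  rewrite -(fineK fA) lee_fin.
  (* This is the bound from the tiling of side [s]; letting [s] tend to 0 from the right removes the
     overshoot. *)
  pose g s := r * \prod_i (Num.max 0 (I.2 0 i - I.1 0 i) + s).
  have g0 : g s @[s --> 0^'+] --> r * box_vol I.
    have -> : box_vol I = \prod_i (Num.max 0 (I.2 0 i - I.1 0 i) + 0).
      by apply: eq_bigr => i _; rewrite addr0.
    apply: cvg_at_right_filter; apply: cvgM; first exact: cvg_cst.
    apply: cvg_big => [|i _]; first exact: mul_continuous.
    by apply: cvgD; [exact: cvg_cst|exact: cvg_id].
  apply: (cvgr_to_ge g0); near=> s.
  rewrite -lee_fin fineK//; apply: leb_tiling; rewrite ?ltW//.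
  move=> Q Qs; rewrite -Qs; apply: small; rewrite Qs.
  by near: s; exact: nbhs_right_lt.
have : (leb A <= r%:E * leb A)%E.
  rewrite -lee_pdivrMl//; apply: le_ereal_inf_tmp => _ [J AJ <-].
  rewrite lee_pdivrMl// -nneseriesZl => [|k _]; last first.
    by rewrite lee_fin box_vol_ge0.
  rewrite -{1}(setIidl AJ).
  apply: le_trans (outer_measure_bigcup_lim leb (fun k => box (J k)) A) _.
  apply: lee_nneseries => [k _ _|k _]; first exact: outer_measure_ge0.
  by rewrite -EFinM; exact: Abox.
have fA : leb A \is a fin_num by rewrite ge0_fin_numE// ltW.
rewrite -(fineK fA) -EFinM lee_fin leNgt gtr_pMl ?r1//.
by rewrite fine_gt0// A0.
Unshelve. all: by end_near. Qed.

End cubes.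

(** * Subsets of prescribed measure and splitting at a median *)

Section median.
Context {R : realType} {n : nat}.
Local Notation Rn := 'rV[R]_n.+1.
Implicit Types (A S : set Rn) (Q P : cube R n).

Lemma leb_slab_le Q A (s t : R) : s <= t -> A `<=` cube_set Q ->
  (leb (A `&` [set x | (s <= x 0 ord0 <= t)%R]) <= (cube_side Q ^+ n * (t - s))%:E)%E.
Proof.
move=> st; rewrite cube_setE; set B := (_, _) => AB.
apply: le_trans
  (@leb_bounded R n _ (set_coord B.1 ord0 s, set_coord B.2 ord0 t) _) _.
  move=> x [/AB Bx /= xst] i; have := Bx i; rewrite !mxE.
  by case: eqP => [->|].
rewrite lee_fin /box_vol big_ord_recl !mxE/= max_r ?subr_ge0// mulrC.
rewrite -[X in _ ^+ X](card_ord n) -prodr_const.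
rewrite ler_wpM2r ?subr_ge0//; apply: ler_prod => i _.
rewrite le_max lexx/= !mxE/= (_ : _ - _ = cube_side Q); last by lra.
by rewrite ge_max lexx (ltW (cube_side_gt0 _)).
Qed.

(** The measure [phi t] of the part of [S] below height [t] is Lipschitz by the slab estimate, and
    grows from 0 to [leb S] as [t] crosses the cube; the intermediate value theorem gives the height
    at which it equals [r]. *)
Lemma subset_of_measure Q S (r : R) : lebesgue_measurable S -> S `<=` cube_set Q ->
  0 <= r -> (r%:E <= leb S)%E ->
  exists F, [/\ lebesgue_measurable F, F `<=` S & leb F = r%:E].
Proof.
move=> mS SQ r0 rS; pose H t := S `&` [set x : Rn | x 0 ord0 <= t].
have fS A : A `<=` S -> leb A \is a fin_num.
  move=> AS; rewrite ge0_fin_numE ?outer_measure_ge0//.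
  apply: le_lt_trans (ltry (cube_side Q ^+ n.+1)); rewrite -leb_cube.
  by apply: le_outer_measure; exact: subset_trans SQ.
have fH t : leb (H t) \is a fin_num by apply: fS; exact: subIsetl.
pose phi t := fine (leb (H t)); pose C := cube_side Q ^+ n.
have C0 : 0 <= C by rewrite exprn_ge0// ltW// cube_side_gt0.
have phi_mono s t : s <= t -> phi s <= phi t.
  move=> st; rewrite -lee_fin !fineK//; apply: le_outer_measure => x [Sx xs].
  by split => //; exact: le_trans st.
have phi_lip s t : s <= t -> phi t <= phi s + C * (t - s).
  move=> st; rewrite -lee_fin EFinD !fineK//.
  apply: (@le_trans _ _ (leb (H s) + leb (S `&` [set x : Rn | (s <= x 0 ord0 <= t)%R]))%E).
    apply: le_trans (outer_measureU2 _ _ _); apply: le_outer_measure => x [Sx xt].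
    have [xs|sx] := leP (x 0 ord0) s; [by left|right; split => //=].
    by rewrite ltW.
  by apply: leeD => //; exact: leb_slab_le.
have phi_dist s t : `|phi s - phi t| <= C * `|s - t|.
  have [st|ts] := leP s t.
    rewrite distrC ger0_norm ?subr_ge0 ?phi_mono// distrC ger0_norm ?subr_ge0//.
    by rewrite lerBlDl phi_lip.
  rewrite ger0_norm ?subr_ge0 ?phi_mono ?(ltW ts)// ger0_norm ?subr_ge0 ?(ltW ts)//.
  by rewrite lerBlDl phi_lip// ltW.
have phi_cont : continuous phi.
  move=> t; apply/cvgrPdist_le => e e0; near=> y.
  apply: le_trans (phi_dist _ _) _.
  (* Replacing [C] by [C + 1] gives a positive constant to divide by. *)
  apply: (@le_trans _ _ ((C + 1) * `|t - y|)).
    by rewrite ler_wpM2r// lerDl.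
  rewrite mulrC -ler_pdivlMr ?ltr_wpDl//.
  by near: y; apply: cvgr_dist_le => //; rewrite divr_gt0// ltr_wpDl.
set c := cube_center Q 0 ord0; set l := cube_side Q / 2.
have l0 : 0 < l by rewrite divr_gt0 ?cube_side_gt0.
have Qlo x : S x -> c - l <= x 0 ord0 <= c + l.
  by move=> /SQ /(_ ord0); rewrite ler_distl.
(* At the lowest height only a face of the cube can meet [S], and a face is a slab of width 0. *)
have phi_lo : phi (c - l) = 0.
  apply/eqP; rewrite eq_le fine_ge0 ?outer_measure_ge0// andbT.
  rewrite -lee_fin fineK// -[X in X%:E](mulr0 C) -[X in C * X](subrr (c - l)).
  apply: le_trans (leb_slab_le (lexx (c - l)) SQ); apply: le_outer_measure.
  by move=> x [Sx xc]; split => //=; have /andP[-> _] := Qlo _ Sx.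
have phi_hi : (phi (c + l))%:E = leb S.
  rewrite fineK//; congr leb; apply/seteqP; split => x; first by case.
  by move=> Sx; split => //=; have /andP[_ ->] := Qlo _ Sx.
have [|||t _ phit] := @IVT R phi (c - l) (c + l) r.
- by lra.
- by apply: continuous_subspaceT.
- have lohi : phi (c - l) <= phi (c + l) by apply: phi_mono; lra.
  by rewrite min_l// max_r// phi_lo r0 -lee_fin phi_hi.
exists (H t); split; last by rewrite -phit fineK.
  by apply: measurableI => //; exact: measurable_coord_le.
exact: subIsetl.
Unshelve. all: by end_near. Qed.

(** Points of [Q] on one side of the level [m] are paired with points of [P] on the other side. With
    [m] between [b x] and [b y], both the sign of [b x - b y] and the comparison with [b x - m]
    follow. *)
Lemma median_half_sets Q P (b : Rn -> R) (m : R) :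
  lebesgue_measurable_fun b -> is_median b P m -> cube_side P = cube_side Q ->
  exists E1 E2 F1 F2 : set Rn,
  [/\ [/\ lebesgue_measurable E1, lebesgue_measurable E2,
          E1 `<=` cube_set Q, E2 `<=` cube_set Q & cube_set Q = E1 `|` E2],
      [/\ lebesgue_measurable F1, lebesgue_measurable F2,
          F1 `<=` cube_set P & F2 `<=` cube_set P],
      (leb F1 = 2^-1%:E * leb (cube_set Q))%E /\
      (leb F2 = 2^-1%:E * leb (cube_set Q))%E,
      (forall x y, E1 x -> F1 y -> b y <= m <= b x) &
      (forall x y, E2 x -> F2 y -> b x <= m <= b y)].
Proof.
move=> mb [med_gt med_lt] PQ.
have mle : lebesgue_measurable [set x | b x <= m].
  have := mb measurableT _ (measurable_itv `]-oo, m]); rewrite setTI.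
  by congr measurable; apply/seteqP; split => x /=; rewrite in_itv.
have mge : lebesgue_measurable [set x | m <= b x].
  have := mb measurableT _ (measurable_itv `[m, +oo[); rewrite setTI.
  by congr measurable; apply/seteqP; split => x /=; rewrite in_itv/= andbT.
(* [D] will be [b <= m] or [m <= b]; its complement is a strict level set, which the median property
   bounds by half of [P], leaving at least half for [D]. *)
have half D : lebesgue_measurable D ->
    (leb (cube_set P `&` ~` D) <= 2^-1%:E * leb (cube_set P))%E ->
    exists F, [/\ lebesgue_measurable F, F `<=` cube_set P `&` D &
      leb F = (2^-1%:E * leb (cube_set Q))%E].
  move=> mD; rewrite !leb_cube PQ -!EFinM.
  move=> leD; apply: (@subset_of_measure P) => //.
  - by apply: measurableI => //; exact: measurable_cube.
  - by rewrite mulr_ge0// exprn_ge0// ltW// cube_side_gt0.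
  - have : (leb (cube_set P) =
      leb (cube_set P `&` D) + leb (cube_set P `&` ~` D))%E by exact: mD.
    rewrite leb_cube PQ.
    have := leD; have := outer_measure_ge0 leb (cube_set P `&` D).
    have := outer_measure_ge0 leb (cube_set P `&` ~` D).
    case: (leb (cube_set P `&` D)) => [u| |]//; last by rewrite leey.
    case: (leb (cube_set P `&` ~` D)) => [v| |]// _ _; rewrite !lee_fin => vh.
    by rewrite -EFinD => -[uv]; lra.
have [|F1 [mF1 sF1 lF1]] := half _ mle.
  apply: le_trans med_gt; apply: le_outer_measure => x [Px] /= /negP.
  by rewrite -ltNge.
have [|F2 [mF2 sF2 lF2]] := half _ mge.
  apply: le_trans med_lt; apply: le_outer_measure => x [Px] /= /negP.
  by rewrite -ltNge.
exists (cube_set Q `&` [set x | m <= b x]), (cube_set Q `&` [set x | b x <= m]).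
exists F1, F2; split.
- split; try exact: subIsetl.
  + by apply: measurableI => //; exact: measurable_cube.
  + by apply: measurableI => //; exact: measurable_cube.
  + rewrite -setIUr; apply/esym/setIidPl => x _ /=.
    by have [|/ltW] := leP m (b x); [left|right].
- by split => // x; [move/sF1|move/sF2] => -[].
- by [].
- by move=> x y [_ /= ->] /sF1[_ /= ->].
- by move=> x y [_ /= ->] /sF2[_ /= ->].
Qed.

End median.

(** * Homogeneous extension and a cube of good directions *)

Section directions.
Context {R : realType} {n : nat}.
Local Notation Rn := 'rV[R]_n.+1.
Implicit Types (x y z : Rn) (f : Rn -> R).

Lemma enormZ (a : R) x : enorm (a *: x) = `|a| * enorm x.
Proof.
rewrite /enorm -sqrtr_sqr -sqrtrM ?sqr_ge0// mulr_sumr.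
by congr Num.sqrt; apply: eq_bigr => i _; rewrite mxE exprMn.
Qed.

Lemma coord_le_enorm x i : `|x 0 i| <= enorm x.
Proof.
rewrite -sqrtr_sqr /enorm ler_wsqrtr// (bigD1 i)//= lerDl.
by apply: sumr_ge0 => j _; exact: sqr_ge0.
Qed.

Lemma enorm0 : enorm (0 : Rn) = 0.
Proof. by rewrite -(scale0r (0 : Rn)) enormZ normr0 mul0r. Qed.

Lemma continuous_enorm : continuous (@enorm R n).
Proof.
move=> x; apply: (@continuous_comp _ _ _ (fun y : Rn => \sum_i y 0 i ^+ 2)
  (@Num.sqrt R)); last exact: sqrt_continuous.
apply: continuous_big => [|i _]; first exact: add_continuous.
move=> y; apply: (@continuous_comp _ _ _ (fun y : Rn => y 0 i) (fun t : R => t ^+ 2)).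
  exact: coord_continuous.
exact: exprn_continuous.
Qed.

Lemma hextZ f (a : R) x : 0 < a -> hext f (a *: x) = hext f x.
Proof.
move=> a0; rewrite /hext enormZ gtr0_norm// scalerA; congr (f (_ *: _)).
by rewrite invfM mulrAC mulVf ?mul1r// gt_eqF.
Qed.

Lemma hext_sphere f x : sphere x -> hext f x = f x.
Proof. by move=> x1; rewrite /hext x1 invr1 scale1r. Qed.

(** The direction is continuous away from the origin. The condition [0 < enorm z] excludes the
    origin, where the inverse takes its default value 0. *)
Lemma open_directions (V : set Rn) : open V ->
  open [set z | 0 < enorm z /\ V ((enorm z)^-1 *: z)].
Proof.
rewrite !openE => oV z [z0 Vz].
have dirz : (enorm y)^-1 *: y @[y --> z] --> (enorm z)^-1 *: z.
  have zn0 : enorm z != 0 by rewrite gt_eqF.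
  exact: cvgZ (cvgV zn0 (@continuous_enorm z)) cvg_id.
near=> y; split; near: y; last exact: dirz _ (oV _ Vz).
exact: cvgr_gt (@continuous_enorm z) _ z0.
Unshelve. all: by end_near. Qed.

(** The cube [K] of the overview. The lower bound on the norm of its center is what later makes [k0]
    exceed [10 * Num.sqrt n.+1%:R]. *)
Lemma dense_cube (Omega : Rn -> R) (d : R) :
  sphere_measurable_fun Omega ->
  (exists U : set Rn, [/\ sphere_open U, constant_sign U Omega &
      sphere_measure (U `&` [set t | Omega t != 0]) <> 0%E]) ->
  0 < d < 1 ->
  exists (eps : R) (K : cube R n),
  [/\ 0 < eps,
      10 * Num.sqrt n.+1%:R * cube_side K < 2 * enorm (cube_center K),
      constant_sign (cube_set K) (hext Omega) &
      (leb (cube_set K `&` [set z | (`|hext Omega z| < eps)%R]) <=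
       (d * cube_side K ^+ n.+1)%:E)%E].
Proof.
move=> mOmega [U [[V oV UV] sU U0]] /andP[d0 d1].
pose O := [set z : Rn | 0 < enorm z /\ V ((enorm z)^-1 *: z)].
pose e N : R := N.+1%:R^-1.
have e0 N : 0 < e N by rewrite invr_gt0.
pose C N := cone (@sphere R n `&` Omega @^-1` [set v | e N <= `|v|]).
have mC N : lebesgue_measurable (C N).
  apply: mOmega; have -> : [set v : R | e N <= `|v|] = ~` `]- e N, e N[%classic.
    apply/seteqP; split => v /=; rewrite in_itv/= -ltr_norml leNgt => /negP//.
  by apply: measurableC; exact: measurable_itv.
have C_hext N z : C N z -> e N <= `|hext Omega z|.
  by move=> [r [t [/andP[r0 _] [st et] ->]]]; rewrite hextZ// hext_sphere.
(* The second condition keeps a sup-norm ball of radius [e N] inside [O], so any cube of side below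
   [e N] that meets [A N] has all its directions in [U]. *)
pose A N := C N `&` [set p | forall y : Rn, (forall i, `|y 0 i - p 0 i| < e N) -> O y].
have [N AN] : exists N, (0 < leb (A N))%E.
  apply: contrapT => noN; apply: U0; rewrite /sphere_measure.
  suff -> : leb (cone (U `&` [set t | Omega t != 0])) = 0%E by rewrite mule0.
  apply/eqP; rewrite eq_le outer_measure_ge0 andbT.
  have A0 N : leb (A N) = 0%E.
    apply/eqP; rewrite eq_le outer_measure_ge0 andbT leNgt; apply/negP => AN.
    by apply: noN; exists N.
  (* The sets [A k] cover the cone over the part of [U] where [Omega] is nonzero, so they cannot all
     be null. *)
  apply: (@le_trans _ _ (\sum_(k <oo) leb (A k))%E); last by rewrite eseries0.
  apply: le_trans (outer_measure_sigma_subadditive leb A).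
  apply: le_outer_measure => _ [r [t [r01 [Ut /= Ot] ->]]].
  have [st Vt] : sphere t /\ V t by move: Ut; rewrite UV.
  have r0 : 0 < r by case/andP: r01.
  have : nbhs (r *: t) O.
    have := open_directions oV; rewrite openE; apply.
    split; first by rewrite enormZ st mulr1 gtr0_norm.
    rewrite enormZ st mulr1 gtr0_norm// scalerA mulVf ?gt_eqF// scale1r.
    exact: Vt.
  move=> /nbhs_ballP[/= a a0 aO].
  have [N Na] : exists N, e N < Num.min a `|Omega t|.
    have m0 : 0 < Num.min a `|Omega t| by rewrite lt_min a0 normr_gt0.
    exists (Num.trunc (Num.min a `|Omega t|)^-1).
    rewrite /e -[ltRHS]invrK ltf_pV2 ?posrE ?invr_gt0 ?ltr0n//.
    have mV0 : 0 <= (Num.min a `|Omega t|)^-1 by rewrite invr_ge0 ltW.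
    by have /andP[_] := truncn_itv mV0.
  move: Na; rewrite lt_min => /andP[Na NO].
  exists N => //; split.
    by exists r, t; split => //; split => //=; exact: ltW.
  move=> y yN; apply: aO; split => // i j; rewrite ord1 /ball/= distrC.
  exact: lt_trans (yN j) Na.
have Aoo : (leb (A N) < +oo)%E.
  apply: le_lt_trans (ltry (box_vol (const_mx (-1) : Rn, const_mx 1))).
  apply: leb_bounded => x [[r [t [/andP[r0 r1] [st _] ->]]] _] i.
  rewrite !mxE -ler_norml normrM gtr0_norm//.
  by rewrite mulr_ile1 ?(ltW r0)// -st coord_le_enorm.
pose q : R := 10 * Num.sqrt n.+1%:R.
have q0 : 0 <= q by rewrite mulr_ge0 ?sqrtr_ge0.
have d1' : 0 < 1 - d < 1 by apply/andP; split; lra.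
(* A side [s] below this threshold gives [s * q + s < e N], which serves both to keep [K] inside [O]
   and to keep it far from the origin relative to its side. *)
have eq0 : 0 < e N / (q + 1) by rewrite divr_gt0// ltr_wpDl.
have [K Ks KA] := cube_density d1' eq0 AN Aoo.
set s := cube_side K in Ks KA *.
have s0 : 0 < s := cube_side_gt0 K.
have sqe : s * q + s < e N.
  by move: Ks; rewrite ltr_pdivlMr ?ltr_wpDl// mulrDr mulr1.
have se : s < e N by apply: le_lt_trans sqe; rewrite lerDr mulr_ge0// ltW.
have [p [Ap Kp]] : A N `&` cube_set K !=set0.
  apply/set0P/eqP => AK0; move: KA; rewrite AK0 outer_measure0 lte_fin ltNge.
  by rewrite mulr_ge0// ?exprn_ge0 ?ltW//; lra.
have KO y : cube_set K y -> O y.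
  move=> Ky; apply: Ap.2 => i; apply: le_lt_trans se.
  rewrite (splitr s); apply: le_trans (ler_distD (cube_center K 0 i) _ _) _.
  by apply: lerD; [exact: Ky|rewrite distrC; exact: Kp].
exists (e N), K; split => //.
(* Otherwise the origin would lie in the ball of radius [e N] around [p], hence in [O]. The center
   of [K] differs from [p] by at most [s / 2] in this coordinate. *)
- have [i pi] : exists i, e N <= `|p 0 i|.
    apply: contrapT => nopi; suff [] : O 0 by rewrite enorm0 ltxx.
    apply: Ap.2 => i; rewrite mxE sub0r normrN ltNge; apply/negP => pi.
    by apply: nopi; exists i.
  have ci := coord_le_enorm (cube_center K) i; have pci := Kp i.
  have := ler_normD (p 0 i - cube_center K 0 i) (cube_center K 0 i).
  by rewrite subrK -/s -/q mulrC => pc; rewrite -/s in pci; lra.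
- have KU y : cube_set K y -> U ((enorm y)^-1 *: y).
    move=> /KO[y0 Vy]; rewrite UV; split => //.
    by rewrite /sphere/= enormZ gtr0_norm ?invr_gt0// mulVf ?gt_eqF.
  by case: sU => sU; [left|right] => y /KU; exact: sU.
(* Measurability of [C N] splits [K] exactly: [C N] takes at least the proportion [1 - d], and all
   points with small [hext Omega] lie in the rest. *)
- have : (leb (cube_set K) =
      leb (cube_set K `&` C N) + leb (cube_set K `&` ~` C N))%E by exact: mC.
  have : (((1 - d) * s ^+ n.+1)%:E <= leb (cube_set K `&` C N))%E.
    apply: le_trans (ltW KA) _; apply: le_outer_measure => x [[Cx _] Kx].
    by split.
  have KC : (leb (cube_set K `&` [set z | (`|hext Omega z| < e N)%R]) <=
      leb (cube_set K `&` ~` C N))%E.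
    apply: le_outer_measure => x [Kx /= hx]; split => // /C_hext.
    by rewrite leNgt hx.
  rewrite leb_cube -/s => uh uv; apply: le_trans KC _; move: uh uv.
  have := outer_measure_ge0 leb (cube_set K `&` ~` C N).
  case: (leb (cube_set K `&` C N)) (leb (cube_set K `&` ~` C N)) =>
    [u| |] [v| |]// _; rewrite !lee_fin => uh.
  by rewrite -EFinD => -[uv]; lra.
Qed.

End directions.

(** * Transfer of the cube of directions to [Q] and its translate [P] *)

Theorem proposition2p4 (R : realType) (n : nat) (Omega : 'rV[R]_n.+1 -> R)
    (mOmega : sphere_measurable_fun Omega)
    (sOmega : exists U : set 'rV[R]_n.+1,
      [/\ sphere_open U,
          constant_sign U Omega &
          sphere_measure (U `&` [set t | Omega t != 0]) <> 0%E])
    (gamma : R) (gamma01 : 0 < gamma < 1) :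
  exists eps0 k0 : R,
  [/\ 0 < eps0,
      10 * Num.sqrt n.+1%:R < k0 &
      forall (b : 'rV[R]_n.+1 -> R) (mb : lebesgue_measurable_fun b)
        (m : cube R n -> R) (medm : forall P, is_median b P (m P))
        (Q : cube R n),
      exists P : cube R n,
      [/\ cube_side P = cube_side Q,
          enorm (cube_center Q - cube_center P) = k0 * cube_side Q &
          exists E1 E2 F1 F2 : set 'rV[R]_n.+1,
          [/\ [/\ lebesgue_measurable E1, lebesgue_measurable E2,
                  E1 `<=` cube_set Q, E2 `<=` cube_set Q &
                  cube_set Q = E1 `|` E2],
              [/\ lebesgue_measurable F1, lebesgue_measurable F2,
                  F1 `<=` cube_set P & F2 `<=` cube_set P] /\
              (leb F1 = 2^-1%:E * leb (cube_set Q) /\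
               leb F2 = 2^-1%:E * leb (cube_set Q))%E &
              [/\ (* (1) *)
                  constant_sign (E1 `*` F1) (fun p => b p.1 - b p.2) /\
                  constant_sign (E2 `*` F2) (fun p => b p.1 - b p.2),
                  (* (2) *)
                  (forall x y, E1 x -> F1 y ->
                     `|b x - m P| <= `|b x - b y|) /\
                  (forall x y, E2 x -> F2 y ->
                     `|b x - m P| <= `|b x - b y|),
                  (* (3) *)
                  constant_sign (cube_set Q `*` cube_set P)
                    (fun p => hext Omega (p.1 - p.2)) &
                  (* (4) *)
                  forall x, cube_set Q x ->
                    (leb ([set y | (`|hext Omega (x - y)| < eps0)%R]
                          `&` cube_set P)
                     <= gamma%:E * leb (cube_set Q))%E]]]].
Proof.
have [g0 g1] := andP gamma01.
(* The factor [2 ^+ n.+1] compensates for the volume of the dilate of [K] of side [2 * l], compared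
   with that of [Q]. *)
have g2 : 0 < gamma / 2 ^+ n.+1 < 1.
  rewrite divr_gt0 ?exprn_gt0//= ltr_pdivrMr ?exprn_gt0// mul1r.
  by apply: lt_le_trans g1 _; rewrite exprn_ege1// ler1n.
have [eps [K [eps0 Kc Ksign Kdense]]] := dense_cube mOmega sOmega g2.
set s := cube_side K in Kc Kdense; set c := cube_center K in Kc.
have s0 : 0 < s := cube_side_gt0 K.
exists eps, (2 * enorm c / s); split => //; first by rewrite ltr_pdivlMr.
move=> b mb m medm Q; set l := cube_side Q.
have l0 : 0 < l := cube_side_gt0 Q.
(* With this ratio [k *: K] has side [2 * l], the side of the cube of differences [x - y], whose
   center is [k *: c]. The centers of [Q] and [P] are thus at distance [k * enorm c], which is
   [k0 * l]. *)
pose k := 2 * l / s.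
have k0 : 0 < k by rewrite divr_gt0// mulr_gt0.
pose P := Cube (cube_center Q - k *: c) l0.
have QPK x y : cube_set Q x -> cube_set P y -> cube_set K (k^-1 *: (x - y)).
  move=> Qx Py i; have := Qx i; have := Py i; rewrite !mxE/= -/l -/s -/c => yi xi.
  have -> : k^-1 * (x 0 i - y 0 i) - c 0 i =
      k^-1 * ((x 0 i - cube_center Q 0 i)
              - (y 0 i - (cube_center Q 0 i - k * c 0 i))).
    by field; rewrite gt_eqF.
  rewrite normrM gtr0_norm ?invr_gt0// mulrC ler_pdivrMr//.
  rewrite (_ : s / 2 * k = l / 2 + l / 2); last first.
    by rewrite /k; field; rewrite gt_eqF.
  by apply: le_trans (ler_normB _ _) _; exact: lerD.
have hK x y : hext Omega (x - y) = hext Omega (k^-1 *: (x - y)).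
  by rewrite hextZ// invr_gt0.
exists P; split => //.
  rewrite opprB addrC subrK enormZ gtr0_norm// /k -/c.
  by field; rewrite gt_eqF.
have [E1 [E2 [F1 [F2 [mE mF lF EF1 EF2]]]]] :=
  @median_half_sets R n Q P b (m P) mb (medm P) erefl.
exists E1, E2, F1, F2; split => //; split.
- split; [left|right] => -[x y] /= [Ex Fy].
    by have /andP[ym mx] := EF1 _ _ Ex Fy; rewrite subr_ge0 (le_trans ym).
  by have /andP[xm my] := EF2 _ _ Ex Fy; rewrite subr_le0 (le_trans xm).
- split => x y Ex Fy.
    have /andP[ym mx] := EF1 _ _ Ex Fy.
    by rewrite !ger0_norm ?subr_ge0 ?(le_trans ym)// lerD2l lerN2.
  have /andP[xm my] := EF2 _ _ Ex Fy.
  by rewrite !ler0_norm ?subr_le0 ?(le_trans xm)// lerN2 lerD2l lerN2.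
- by case: Ksign => Ks; [left|right] => -[x y] /= [Qx Py];
    rewrite hK; apply: Ks; exact: QPK.
- move=> x Qx.
  (* For fixed [x], the substitution [z = k^-1 *: (x - y)] carries the bad points [y] of [P] to bad
     points of [K], so they lie in an affine image of ratio [- k]. *)
  apply: (@le_trans _ _ (leb [set (x + (- k) *: z)%R | z in
      cube_set K `&` [set z | (`|hext Omega z| < eps)%R]])).
    apply: le_outer_measure => y [/= hy Py].
    exists (k^-1 *: (x - y)); first by split; [exact: QPK|rewrite /= -hK].
    by rewrite scalerA mulNr mulfV ?gt_eqF// scaleN1r opprB addrC subrK.
  apply: le_trans (leb_affine _ _ _) _; first by rewrite oppr_eq0 gt_eqF.
  rewrite normrN gtr0_norm// leb_cube -/l.
  apply: le_trans (lee_wpmul2l _ Kdense) _; first by rewrite lee_fin exprn_ge0// ltW.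
  rewrite -!EFinM lee_fin mulrCA -exprMn /k divfK ?gt_eqF//.
  by rewrite exprMn mulrA divfK ?gt_eqF ?exprn_gt0.
Qed.
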